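(* Let $G=(V,E)$ be a finite (not necessarily planar) graph with coupling constants $J:E\to(0,\infty)$, and let $A\subseteq V$ be a set of even cardinality (possibly empty) such that $\Omega_A\neq\emptyset$. Let $x_e=\tanh J_e$. The probability of $\omega=(\omega_1,\omega_2)\in\Gamma_A$ induced from the double random current measure $\mathbf P^A_{\mathrm{d\text{-}curr}}$ is given by $$\overline{\mathbf P}^A_{\mathrm{d\text{-}curr}}(\omega)=\frac1{\bar Z^A_{\mathrm{d\text{-}curr}}}\,|\mathcal E_\emptyset(\omega)|\prod_{e\in\omega_1}x_e\prod_{e\in\omega_2}x_e^2\prod_{e\in E\setminus\omega}(1-x_e^2),$$ where $\bar Z^A_{\mathrm{d\text{-}curr}}=Z^A_{\mathrm{curr}}Z^\emptyset_{\mathrm{curr}}\prod_{e\in E}(1-x_e^2)$.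
   Context: Random currents: a current on $G$ is a function $\mathbf n:E\to\{0,1,2,\dots\}$. Its set of sources $\partial\mathbf n$ is the set of vertices $v$ such that $\sum_{u:\{u,v\}\in E}\mathbf n_{\{u,v\}}$ is odd. $\Omega_A=\{\mathbf n:\partial\mathbf n=A\}$. The weight of a current is $\mathrm w(\mathbf n)=\prod_{e\in E}\frac{(J_e)^{\mathbf n_e}}{\mathbf n_e!}$. The random current measure with boundary conditions $A$ is $\mathbf P^A_{\mathrm{curr}}(\mathbf n)=\mathrm w(\mathbf n)/Z^A_{\mathrm{curr}}$ for $\mathbf n\in\Omega_A$, with $Z^A_{\mathrm{curr}}=\sum_{\mathbf n\in\Omega_A}\mathrm w(\mathbf n)$. The double random current measure $\mathbf P^A_{\mathrm{d\text{-}curr}}$ on $\Omega_A$ is the law of $\mathbf n_1+\mathbf n_2$, where $\mathbf n_1,\mathbf n_2$ are independent with laws $\mathbf P^A_{\mathrm{curr}}$ and $\mathbf P^\emptyset_{\mathrm{curr}}$ respectively. Induced configurations: to $\mathbf n\in\Omega_A$ associate $\omega(\mathbf n)=(\omega_1(\mathbf n),\omega_2(\mathbf n))$ with $\omega_1(\mathbf n)=\{e:\mathbf n_e\text{ is odd}\}$ and $\omega_2(\mathbf n)=\{e:\mathbf n_e\text{ is even},\ \mathbf n_e\ne0\}$. Let $\mathcal E_A$ be the collection of sets of edges for which $A$ is the set of vertices of odd degree in the induced subgraph, and let $\Gamma_A=\{\omega(\mathbf n):\mathbf n\in\Omega_A\}=\{(\omega_1,\omega_2):\omega_1\in\mathcal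 E_A,\ \omega_2\subseteq E\setminus\omega_1\}$. The induced measure $\overline{\mathbf P}^A_{\mathrm{d\text{-}curr}}$ on $\Gamma_A$ is the push-forward of $\mathbf P^A_{\mathrm{d\text{-}curr}}$ under $\mathbf n\mapsto\omega(\mathbf n)$. A pair $\omega\in\Gamma_A$ is often identified with the set $\omega_1\cup\omega_2\subseteq E$. For $\omega\subseteq E$, $\mathcal E_\emptyset(\omega)=\{\omega'\in\mathcal E_\emptyset:\omega'\subseteq\omega\}$. *)

(* Defs.v *)
From HB Require Import structures.
From mathcomp Require Import all_boot all_order all_algebra.
From mathcomp Require Import all_classical all_reals all_analysis.

Set Implicit Arguments.
Unset Strict Implicit.
Unset Printing Implicit Defensive.

Import Order.TTheory GRing.Theory Num.Theory.
Import numFieldNormedType.Exports.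

Local Open Scope classical_set_scope.
Local Open Scope ring_scope.

Definition tanh {R : realType} (t : R) : R :=
  (expR t - expR (- t)) / (expR t + expR (- t)).

(* A finite graph is given by its set of edges, each an unordered pair of
   distinct vertices. *)
Definition simple_graph (V : finType) (E : {set {set V}}) : Prop :=
  forall e, e \in E -> #|e| = 2%N.

Notation edge E := {e | e \in E}.

Section currents.
Context {V : finType} {E : {set {set V}}}.

Definition current_of (E : {set {set V}}) := {ffun edge E -> nat}.
HB.instance Definition _ := Countable.on (current_of E).
HB.instance Definition _ := isPointed.Build (current_of E) [ffun=> 0%N].
HB.instance Definition _ := @isMeasurable.Build default_measure_display
  (current_of E) discrete_measurable discrete_measurable0
  discrete_measurableC discrete_measurableU.

Definition config_of (E : {set {set V}}) :=
  ({set edge E} * {set edge E})%type.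
HB.instance Definition _ := Finite.on (config_of E).
HB.instance Definition _ := isPointed.Build (config_of E)
  (finset.set0, finset.set0).
HB.instance Definition _ := @isMeasurable.Build default_measure_display
  (config_of E) discrete_measurable discrete_measurable0
  discrete_measurableC discrete_measurableU.

Notation current := (current_of E).
Notation config := (config_of E).

(* The edges containing v are exactly the pairs {u, v} belonging to E, each
   determined by u, so this is the sum over neighbours of v. *)
Definition sources (n : current) : {set V} :=
  [set v | odd (\sum_(e : edge E | v \in val e) n e)%N]%SET.

Definition Omega (A : {set V}) : set current := [set n | sources n = A].

Definition current_add (n1 n2 : current) : current :=
  [ffun e => (n1 e + n2 e)%N].

Definition conf (n : current) : config :=
  ([set e | odd (n e)]%SET, [set e | ~~ odd (n e) & n e != 0%N]%SET).

Definition conf_edges (w : config) : {set edge E} := w.1 :|: w.2.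

Definition Gamma (A : {set V}) : set config := [set conf n | n in Omega A].

Definition odd_vertices (eta : {set edge E}) : {set V} :=
  [set v | odd #|[set e in eta | v \in val e]%SET|]%SET.

Definition parity_sets (A : {set V}) : {set {set edge E}} :=
  [set eta | odd_vertices eta == A]%SET.

Definition parity_subsets (A : {set V}) (w : {set edge E}) :
    {set {set edge E}} :=
  [set eta in parity_sets A | eta \subset w]%SET.

End currents.

Notation current := current_of.
Notation config := config_of.

Section measures.
Context {R : realType} {V : finType} {E : {set {set V}}}.
Variable J : edge E -> {posnum R}.
Local Open Scope ereal_scope.

Definition weight (n : current E) : R :=
  (\prod_e ((J e)%:num ^+ n e / (n e)`!%:R))%R.

(* The sum over all currents is \prod_e exp (J e), hence [fine] is applied to a
   finite value. *)
Definition Zcurr (A : {set V}) : R := fine (\esum_(n in Omega A) (weight n)%:E).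

(* Measures on Omega A are represented as measures on the discrete space of
   all currents, carried by Omega A. *)
Definition curr (A : {set V}) : set (current E) -> \bar R :=
  fun S => \esum_(n in Omega A `&` S) (weight n / Zcurr A)%:E.

Lemma weight_ge0 n : (0 <= weight n)%R.
Proof. by apply: prodr_ge0 => e _; rewrite divr_ge0// exprn_ge0. Qed.

Lemma Zcurr_ge0 A : (0 <= Zcurr A)%R.
Proof.
by rewrite fine_ge0// esum_ge0// => n _; rewrite lee_fin weight_ge0.
Qed.

Let wZ_ge0 A n : 0 <= (weight n / Zcurr A)%:E.
Proof. by rewrite lee_fin divr_ge0// ?weight_ge0// Zcurr_ge0. Qed.

Section curr_measure.
Variable A : {set V}.

Let curr0 : curr A set0 = 0.
Proof. by rewrite /curr setI0 esum_set0. Qed.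

Let curr_ge0 S : 0 <= curr A S.
Proof. by rewrite /curr esum_ge0. Qed.

Let curr_sigma_additive : semi_sigma_additive (curr A).
Proof.
move=> F mF tF mUF; rewrite /curr setI_bigcupr nneseries_sum_bigcup//.
  by apply: is_cvg_nneseries => n _ _; exact: esum_ge0.
exact: trivIset_setIl.
Qed.

HB.instance Definition _ := isMeasure.Build _ _ _ (curr A)
  curr0 curr_ge0 curr_sigma_additive.

Let curr_setT : curr A setT <= 1.
Proof.
rewrite /curr setIT; set Z := Zcurr A.
have [Z0|Zn0] := eqVneq Z 0%R.
  by rewrite esum1 ?lee01// => n _; rewrite Z0 invr0 mulr0.
have Zgt0 : (0 < Z)%R by rewrite lt_neqAle eq_sym Zn0 Zcurr_ge0.
apply: ge_ereal_sup => _ [X [finX XA] <-].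
have -> : \sum_(n \in X) (weight n / Z)%:E =
    (\sum_(n \in X) (weight n)%:E) * (Z^-1)%:E.
  rewrite !fsbig_finite//= ge0_sume_distrl//.
  by move=> n _; rewrite lee_fin weight_ge0.
rewrite muleC lee_pdivrMl// mule1.
have Zfin : \esum_(n in Omega A) (weight n)%:E \is a fin_num.
  by apply: contraNT Zn0; rewrite /Z /Zcurr; case: (esum _ _).
by rewrite /Z /Zcurr fineK//; apply: esum_ge; exists X.
Qed.

HB.instance Definition _ := Measure_isSubProbability.Build _ _ _ (curr A)
  curr_setT.

End curr_measure.

(* The product measure makes the two currents independent. *)
Definition dcurr (A : {set V}) : set (current E) -> \bar R :=
  pushforward (curr A \x curr finset.set0)
    (fun n : current E * current E => current_add n.1 n.2).

Definition dcurr_induced (A : {set V}) : set (config E) -> \bar R :=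
  pushforward (dcurr A) conf.

Definition Zdcurr_bar (A : {set V}) : R :=
  (Zcurr A * Zcurr finset.set0 * \prod_e (1 - tanh (J e)%:num ^+ 2))%R.

End measures.

(* Main.v *)
Require Import Defs.
From mathcomp Require Import all_boot all_order all_algebra.
From mathcomp Require Import all_classical all_reals all_analysis.
From mathcomp Require Import ring.
Import Order.TTheory GRing.Theory Num.Theory.
Import numFieldNormedType.Exports.
Local Open Scope classical_set_scope.
Local Open Scope ring_scope.

(** The probability of [w] is a double sum of weights over the pairs [n1], [n2]
    with [n1] in [Omega A], [n2] in [Omega set0] and [conf (n1 + n2) = w].  The
    idea is to sort these pairs by the set [eta] of edges where [n2] is odd.

    Sources are additive modulo 2 and [w] lies in [Gamma A].  So, once
    [conf (n1 + n2) = w], the two source conditions together say only that [eta]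
    has no vertex of odd degree ([indicator_sum_parity]).  For a fixed [eta] the
    remaining conditions concern each edge separately: the parity of [n1 + n2],
    whether [n1 + n2] vanishes, and the parity of [n2].  The weights are products
    over the edges as well, so the double sum factorizes ([esum_ffun_prod]) into
    one double exponential series per edge.

    On an edge of coupling [t] these series are hyperbolic
    ([esum_edge_marginal], [esum_edge_weight]).  On [w.1] one of [n1], [n2] is odd
    and the other even, which gives [sinh t * cosh t].  On [w.2] both are odd,
    which gives [sinh t ^ 2], or both are even and not both zero, which gives
    [cosh t ^ 2 - 1], the same number.  Off [w] both vanish, which gives 1, and
    this excludes the edge from [eta].  Hence each even [eta] contained in [w]
    contributes the same product and the others contribute nothing: the number of
    such [eta] is the factor [#|parity_subsets set0 (conf_edges w)|]
    ([dcurr_induced_cosh_sinh]).  Dividing each edge factor by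
    [cosh t ^ 2 = 1 / (1 - tanh t ^ 2)] turns the product into the stated one.

    The measure-theoretic product is brought to this elementary form by the fact
    that integrals over a countable discrete space are sums
    ([integral_countable]). *)

(** * Sums of nonnegative families *)

Lemma le_esumZl {R : realType} {T : choiceType} (S : set T) (c : R)
    (a : T -> \bar R) : 0 <= c -> (forall i, (0 <= a i)%E) ->
  (\esum_(i in S) (c%:E * a i) <= c%:E * \esum_(i in S) a i)%E.
Proof.
move=> c0 a0; apply: ge_ereal_sup => _ [X [finX XS] <-].
have -> : (\sum_(i \in X) (c%:E * a i) = c%:E * \sum_(i \in X) a i)%E.
  by rewrite !fsbig_finite//= ge0_sume_distrr.
by apply: lee_wpmul2l; rewrite ?lee_fin//; apply: esum_ge; exists X.
Qed.

(** The converse inequality is [le_esumZl] for the inverse constant. *)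
Lemma esumZl {R : realType} {T : choiceType} (S : set T) (c : R)
    (a : T -> \bar R) : 0 <= c -> (forall i, (0 <= a i)%E) ->
  (\esum_(i in S) (c%:E * a i) = c%:E * \esum_(i in S) a i)%E.
Proof.
move=> c0 a0; have [->|cn0] := eqVneq c 0.
  by rewrite mul0e; apply: esum1 => i _; rewrite mul0e.
have cgt0 : 0 < c by rewrite lt_neqAle eq_sym cn0.
apply/eqP; rewrite eq_le le_esumZl//=.
rewrite muleC -lee_pdivlMr// muleC.
apply: le_trans (le_esumZl _ _ _ _ _); last 2 first.
- by rewrite invr_ge0.
- by move=> i; rewrite mule_ge0.
by apply: le_esum => i _; rewrite muleA -EFinM mulVf// mul1e.
Qed.

(** [supported (enum I)] is everything, while [supported (i :: s)] is in bijection
    with [nat * supported s]: the induction over [s] adds one coordinate at a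
    time. *)
Definition supported {I : finType} (s : seq I) : set {ffun I -> nat} :=
  [set n | forall i, i \notin s -> n i = 0%N].

Lemma supported_cons_bij {I : finType} (i : I) (s : seq I) : i \notin s ->
  set_bij ([set: nat] `*`` (fun=> supported s)) (supported (i :: s))
    (fun kn => [ffun j => if j == i then kn.1 else kn.2 j]).
Proof.
move=> is_; split.
- move=> [k n] /= [_ sn] j; rewrite inE negb_or ffunE => /andP[/negbTE-> js].
  exact: sn.
- move=> [k n] [k' n'] /set_mem[/= _ sn] /set_mem[/= _ sn'] /ffunP eqn.
  congr pair; first by have := eqn i; rewrite !ffunE eqxx.
  apply/ffunP => j; have := eqn j; rewrite !ffunE.
  by case: eqP => // -> _; rewrite sn// sn'.
- move=> n /= sn; exists (n i, [ffun j => if j == i then 0%N else n j]).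
    split => //= j js; rewrite ffunE; case: eqP => // /eqP ji.
    by rewrite sn// inE negb_or ji.
  by apply/ffunP => j; rewrite !ffunE /=; case: eqP => [->|].
Qed.

Lemma esum_supported_prod {R : realType} {I : finType} (g : I -> nat -> R)
    (G : I -> R) (s : seq I) :
  (forall i k, 0 <= g i k) ->
  (forall i, \esum_(k in [set: nat]) (g i k)%:E = (G i)%:E)%E ->
  uniq s ->
  (\esum_(n in supported s) (\prod_(i <- s) g i (n i))%:E =
   (\prod_(i <- s) G i)%:E)%E.
Proof.
move=> g0 gG; elim: s => [_|i s IHs /= /andP[is_ us]].
  have -> : supported [::] = [set [ffun=> 0%N]] :> set {ffun I -> nat}.
    apply/seteqP; split => [n n0|_ -> i _]; last by rewrite ffunE.
    by apply/ffunP => i; rewrite n0// ffunE.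
  by rewrite esum_set1 !big_nil// lee_fin.
rewrite (reindex_esum _ _ _ _ (supported_cons_bij _ _ is_)).
transitivity (\esum_(k in [set: nat]) \esum_(n in supported s)
    ((g i k)%:E * (\prod_(j <- s) g j (n j))%:E))%E.
  rewrite esum_esum; last first.
    by move=> *; rewrite -EFinM lee_fin mulr_ge0// prodr_ge0.
  apply: eq_esum => -[k n] _ /=; rewrite -EFinM big_cons ffunE eqxx.
  congr (_ * _)%:E; apply: eq_big_seq => j js; rewrite ffunE.
  by case: eqP js is_ => // -> ->.
under eq_esum => k _.
  rewrite esumZl//; last by move=> n; rewrite lee_fin prodr_ge0.
  rewrite IHs// muleC; over.
rewrite esumZl; first by rewrite gG -EFinM big_cons mulrC.
  apply: prodr_ge0 => j _; rewrite -lee_fin -gG esum_ge0// => k _.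
  by rewrite lee_fin.
by move=> k; rewrite lee_fin.
Qed.

(** Turns a sum over all currents into one series per edge. *)
Lemma esum_ffun_prod {R : realType} {I : finType} (g : I -> nat -> R)
    (G : I -> R) :
  (forall i k, 0 <= g i k) ->
  (forall i, \esum_(k in [set: nat]) (g i k)%:E = (G i)%:E)%E ->
  (\esum_(n in [set: {ffun I -> nat}]) (\prod_i g i (n i))%:E =
   (\prod_i G i)%:E)%E.
Proof.
move=> g0 gG.
have := esum_supported_prod g G (index_enum I) g0 gG (index_enum_uniq I).
rewrite (_ : supported _ = setT)//.
by apply/seteqP; split => // n _ i; rewrite mem_index_enum.
Qed.

(** An enumeration cuts the space into countably many sets with at most one point,
    and the integral over a singleton is the value times the mass. *)
Lemma integral_countable {d} {T : measurableType d} {R : realType}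
    (mu : {measure set T -> \bar R}) (f : T -> \bar R) :
  (forall S : set T, measurable S) -> countable [set: T] ->
  (forall x, (0 <= f x)%E) ->
  (\int[mu]_x f x = \esum_(x in [set: T]) (f x * mu [set x]))%E.
Proof.
move=> mT /countable_injP[g g_inj] f0.
pose F k := [set x | g x = k].
have FT : \bigcup_k F k = setT by apply/seteqP; split => // x _; exists (g x).
have tF : trivIset setT F by move=> i j _ _ [x [<- <-]].
rewrite -FT (ge0_integral_bigcup mu (fun k => mT (F k)))//.
rewrite nneseries_sum_bigcup//; last by move=> x; rewrite mule_ge0.
apply: eq_eseriesr => k _.
have [[x xk]|Fk0] := pselect (F k !=set0); last first.
  have -> : F k = set0 by apply/seteqP; split => // x xk; apply: Fk0; exists x.
  by rewrite integral_set0 esum_set0.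
have -> : F k = [set x].
  apply/seteqP; split => [y yk|_ -> //]; apply: g_inj; rewrite ?inE//.
  by rewrite xk.
rewrite esum_set1 ?mule_ge0// -integral_cst//.
by apply: eq_integral => y /set_mem ->.
Qed.

Lemma esum_series {R : realType} (u : nat -> R) (l : R) :
  (forall k, 0 <= u k) -> series u @ \oo --> l ->
  (\esum_(k in [set: nat]) (u k)%:E = l%:E)%E.
Proof.
move=> u0 ul; rewrite -nneseries_esumT; last by move=> k; rewrite lee_fin.
rewrite (_ : (fun n => _) = EFin \o series u); last first.
  by apply/funext => n /=; rewrite sumEFin.
by rewrite EFin_lim ?(cvg_lim _ ul)//; apply: cvgP ul.
Qed.

(** * The double exponential series of one edge *)

(** The part of the exponential series with exponents of parity [b]:
    [cosh t] for [b = false] and [sinh t] for [b = true]. *)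
Definition parity_exp {R : realType} (b : bool) (t : R) : R :=
  (expR t + (-1) ^+ b * expR (- t)) / 2.

Lemma parity_exp_ge0 {R : realType} (b : bool) (t : R) : 0 <= t ->
  0 <= parity_exp b t.
Proof.
move=> t0; rewrite divr_ge0//; case: b; rewrite ?expr0 ?mul1r ?expr1.
  by rewrite mulN1r subr_ge0 ler_expR ge0_cp.
by rewrite addr_ge0// expR_ge0.
Qed.

Lemma parity_expDB {R : realType} (t : R) :
  parity_exp false t ^+ 2 - parity_exp true t ^+ 2 = 1.
Proof.
have := expRxMexpNx_1 t; rewrite /parity_exp expr0 expr1 => e1.
by field: e1.
Qed.

Lemma cvg_series_parity {R : realType} (b : bool) (t : R) :
  series (fun k => (odd k == b)%:R * exp_coeff t k) @ \oo --> parity_exp b t.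
Proof.
have -> : (fun k => (odd k == b)%:R * exp_coeff t k) =
    2^-1 *: (exp_coeff t + (-1) ^+ b *: exp_coeff (- t)).
  apply/funext => k; rewrite !fctE /exp_coeff /=.
  rewrite (exprNn t) -(signr_odd _ k) /GRing.scale /=.
  by case: (odd k); case: b; rewrite /= ?expr0 ?expr1; field;
    rewrite pnatr_eq0 -lt0n fact_gt0.
rewrite /parity_exp mulrC seriesZ seriesD seriesZ.
apply: cvgZl_tmp; apply: cvgD; first exact: is_cvg_series_exp_coeff.
by apply: cvgZl_tmp; exact: is_cvg_series_exp_coeff.
Qed.

Lemma cvg_series_at0 {R : realType} (c : R) :
  series (fun k => (k == 0%N)%:R * c) @ \oo --> c.
Proof.
rewrite -(cvg_shiftS (series _)) (_ : [sequence _]_n = cst c); first exact: cvg_cst.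
apply/funext => n; rewrite /= seriesEnat /= big_nat_recl//= mul1r big1 ?addr0//.
by move=> i _; rewrite mul0r.
Qed.

(** To be used for the multiplicities [a] of [n1] and [b] of [n2] on an edge, with
    [o], [p] and [h] telling whether this edge is in [w.1], [conf_edges w] and
    [eta]. *)
Definition edge_compat (o p h : bool) (a b : nat) : bool :=
  [&& odd (a + b) == o, (a + b != 0)%N == p & odd b == h].

(** The value of the inner series, over [b], when [a] is fixed.  If [p] holds, the
    parities of [a] and [b] are prescribed and the pair [a = b = 0] is removed,
    which matters only when both prescribed parities are even. *)
Definition edge_marginal {R : realType} (o p h : bool) (t : R) (a : nat) : R :=
  if p then (odd a == o (+) h)%:R * parity_exp h t
            - (a == 0%N)%:R * (~~ o && ~~ h)%:R
  else (a == 0%N)%:R * (~~ h)%:R.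

Lemma esum_edge_marginal {R : realType} (o p h : bool) (t : R) (a : nat) :
  0 <= t -> o ==> p ->
  (\esum_(b in [set: nat]) ((edge_compat o p h a b)%:R * exp_coeff t b)%:E =
   (edge_marginal o p h t a)%:E)%E.
Proof.
move=> t0 op; apply: esum_series => [k|].
  by rewrite mulr_ge0// exp_coeff_ge0.
rewrite /edge_marginal; case: p op => [_|].
  have -> : (fun k => (edge_compat o true h a k)%:R * exp_coeff t k) =
    (odd a == o (+) h)%:R *: (fun k => (odd k == h)%:R * exp_coeff t k)
    - (fun k => (k == 0%N)%:R * ((a == 0%N)%:R * (~~ o && ~~ h)%:R)).
    apply/funext => k; rewrite !fctE -[_ *: _]/(_ * _) /edge_compat oddD.
    rewrite addn_eq0 eqb_id.
    case: k => [|k]; last first.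
      rewrite -[k.+1 == 0%N]/false andbF mul0r subr0 [RHS]mulrA -natrM mulnb.
      congr (_%:R * _); move: (odd k.+1) => c.
      by case: (odd a); case: c; case: h; case: o.
    rewrite /exp_coeff /= expr0 fact0 divr1 !mulr1 mul1r andbT.
    rewrite -!natrM !mulnb; case: a => [|a] /=; last first.
      rewrite subr0.
      by case: (odd a); case: h; case: o.
    by case: h; case: o => /=; rewrite ?subrr ?subr0.
  rewrite seriesD seriesN seriesZ; apply: cvgB; last exact: cvg_series_at0.
  by apply: cvgZl_tmp; exact: cvg_series_parity.
rewrite implybF => /negbTE->.
have -> : (fun k => (edge_compat false false h a k)%:R * exp_coeff t k) =
    (fun k => (k == 0%N)%:R * ((a == 0%N)%:R * (~~ h)%:R)).
  apply/funext => k; rewrite /edge_compat addn_eq0.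
  case: k => [|k]; last by rewrite -[k.+1 == 0%N]/false !andbF !mul0r.
  rewrite /exp_coeff /= expr0 fact0 divr1 !mulr1 mul1r andbT.
  by rewrite -natrM mulnb; case: a => [|a]; case: h; rewrite /= ?andbF.
exact: cvg_series_at0.
Qed.

Lemma edge_marginal_ge0 {R : realType} (o p h : bool) (t : R) (a : nat) :
  0 <= t -> o ==> p -> 0 <= edge_marginal o p h t a.
Proof.
move=> t0 op; rewrite -lee_fin -esum_edge_marginal// esum_ge0// => b _.
by rewrite lee_fin mulr_ge0// exp_coeff_ge0.
Qed.

(** The total weight of an edge.  It does not mention [h], since
    [cosh t ^ 2 - 1 = sinh t ^ 2]: this is why all the sets [eta] contained in [w]
    contribute equally. *)
Definition edge_weight {R : realType} (o p : bool) (t : R) : R :=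
  if p then parity_exp true t * parity_exp (~~ o) t else 1.

(** The factor [h ==> p] records that an edge without current is not in [eta]. *)
Lemma esum_edge_weight {R : realType} (o p h : bool) (t : R) :
  0 <= t -> o ==> p ->
  (\esum_(a in [set: nat]) (exp_coeff t a * edge_marginal o p h t a)%:E =
   ((h ==> p)%:R * edge_weight o p t)%:E)%E.
Proof.
move=> t0 op; apply: esum_series => [k|].
  by rewrite mulr_ge0 ?exp_coeff_ge0 ?edge_marginal_ge0.
rewrite /edge_weight /edge_marginal; case: p op => [_|].
  rewrite implybT mul1r.
  have -> : (fun k => exp_coeff t k * ((odd k == o (+) h)%:R * parity_exp h t
            - (k == 0%N)%:R * (~~ o && ~~ h)%:R)) =
    parity_exp h t *: (fun k => (odd k == o (+) h)%:R * exp_coeff t k)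
    - (fun k => (k == 0%N)%:R * ((~~ o && ~~ h)%:R)).
    apply/funext => k; rewrite !fctE -[_ *: _]/(_ * _).
    case: k => [|k]; last by rewrite /=; ring.
    by rewrite /exp_coeff /= expr0 fact0 divr1; ring.
  (* Only [o = h = false] is not immediate: there [cosh t ^ 2 - 1 = sinh t ^ 2]. *)
  have -> : parity_exp true t * parity_exp (~~ o) t =
      parity_exp h t * parity_exp (o (+) h) t - (~~ o && ~~ h)%:R.
    case: o; case: h => /=; rewrite ?subr0//; first exact: mulrC.
    by rewrite -(parity_expDB t); ring.
  rewrite seriesD seriesN seriesZ; apply: cvgB; last exact: cvg_series_at0.
  by apply: cvgZl_tmp; exact: cvg_series_parity.
move=> _; rewrite implybF mulr1.
have -> : (fun k => exp_coeff t k * ((k == 0%N)%:R * (~~ h)%:R)) =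
    (fun k => (k == 0%N)%:R * (~~ h)%:R).
  apply/funext => -[|k]; last by rewrite !mul0r mulr0.
  by rewrite /exp_coeff /= expr0 fact0 divr1 mul1r.
exact: cvg_series_at0.
Qed.

(** * The induced measure as a double sum *)

Lemma curr_set1 {R : realType} {V : finType} {E : {set {set V}}}
    (J : edge E -> {posnum R}) (A : {set V}) (n : current E) :
  curr J A [set n] = ((n \in Omega A)%:R * (weight J n / Zcurr J A))%:E.
Proof.
rewrite /curr; have [nA|nA] := boolP (n \in Omega A).
  rewrite setIC (_ : [set n] `&` _ = [set n]).
    by rewrite esum_set1 ?mul1r// lee_fin divr_ge0 ?weight_ge0// Zcurr_ge0.
  by apply/seteqP; split => [_ []//|_ ->]; split => //; exact: set_mem.
rewrite mul0r (_ : _ `&` _ = set0) ?esum_set0//.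
apply/seteqP; split => // m [mA mn]; move/negP: nA; apply.
by rewrite -mn; exact: mem_set.
Qed.

Lemma dcurr_inducedE {R : realType} {V : finType} {E : {set {set V}}}
    (J : edge E -> {posnum R}) (A : {set V}) (w : config E) :
  (dcurr_induced J A [set w] =
   \esum_(n1 in [set: current E]) \esum_(n2 in [set: current E])
     ([&& n1 \in Omega A, n2 \in Omega finset.set0
        & conf (current_add n1 n2) == w]%:R *
      (weight J n1 / Zcurr J A * (weight J n2 / Zcurr J finset.set0)))%:E)%E.
Proof.
rewrite /dcurr_induced /dcurr /pushforward /product_measure1.
rewrite integral_countable//; last exact: (@countableP (current_of E)).
apply: eq_esum => n1 _; rewrite /= muleC curr_set1 -esumZl; last first.
- by move=> n2; rewrite lee_fin divr_ge0 ?weight_ge0// Zcurr_ge0.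
- by rewrite mulr_ge0// divr_ge0 ?weight_ge0// Zcurr_ge0.
rewrite esum_mkcond; apply: eq_esum => n2 _; rewrite -EFinM.
have -> : (n2 \in Omega finset.set0 `&` xsection
      ((fun n => current_add n.1 n.2) @^-1` (conf @^-1` [set w])) n1) =
    (n2 \in Omega finset.set0) && (conf (current_add n1 n2) == w).
  rewrite in_setI; congr (_ && _); apply/idP/eqP.
    by rewrite /xsection inE /= => /set_mem.
  by move=> nw; apply/mem_set; rewrite /xsection /=; apply/mem_set.
case: (n1 \in Omega A); case: ifPn => _ //=; rewrite ?mul1r ?mul0r//.
Qed.

(** * Sorting pairs of currents by the odd edges of the second one *)

Lemma sourcesE {V : finType} {E : {set {set V}}} (n : current E) :
  sources n = odd_vertices (conf n).1.
Proof.
apply/setP => v; rewrite !inE.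
have -> : odd (\sum_(e : edge E | v \in val e) n e) =
    odd (\sum_(e : edge E | v \in val e) odd (n e)).
  by elim/big_ind2 : _ => [//|x1 x2 y1 y2|e _]; rewrite ?oddD ?oddb// => -> ->.
rewrite -sum1_card big_mkcond [in RHS]big_mkcond.
by congr (odd _); apply: eq_bigr => e _; rewrite !inE andbC; case: (v \in _).
Qed.

Lemma sources_current_add {V : finType} {E : {set {set V}}}
    (n1 n2 : current E) : sources n2 = finset.set0 ->
  sources (current_add n1 n2) = sources n1.
Proof.
move=> /setP n20; apply/setP => v; have := n20 v; rewrite !inE => n2v.
under eq_bigr do rewrite ffunE.
by rewrite big_split/= oddD n2v addbF.
Qed.

(** The last argument of [edge_compat] is set so that its parity condition on [n2]
    is void; it becomes a constraint once [eta] is chosen independently of [n2]. *)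
Lemma conf_addE {V : finType} {E : {set {set V}}} (w : config E)
    (n1 n2 : current E) : (forall e, e \in w.1 -> e \notin w.2) ->
  (conf (current_add n1 n2) == w) =
  [forall e, edge_compat (e \in w.1) (e \in conf_edges w) (odd (n2 e))
     (n1 e) (n2 e)].
Proof.
case: w => w1 w2 /= dw; apply/eqP/forallP => [[<- <-] e|nw].
  rewrite /edge_compat /conf_edges !inE !ffunE /= !eqxx.
  by case: (n1 e + n2 e)%N => // k; rewrite /= ?andbT; case: odd.
have dwe e : e \in w1 -> e \in w2 = false by move/dw/negbTE.
congr pair; apply/setP => e; have /and3P[/eqP o /eqP p _] := nw e;
  move: p (dwe e); rewrite !inE !ffunE o.
  by [].
by move=> -> /=; case: (e \in w1) => //= ->.
Qed.

Lemma Gamma_disjoint {V : finType} {E : {set {set V}}} (A : {set V})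
    (w : config E) (e : edge E) : Gamma A w -> e \in w.1 -> e \notin w.2.
Proof. by case=> n _ <-; rewrite !inE => ->. Qed.

Lemma Gamma_parity {V : finType} {E : {set {set V}}} (A : {set V})
    (w : config E) : Gamma A w -> odd_vertices w.1 = A.
Proof. by case=> n <- <-; rewrite -sourcesE. Qed.

(** At most one [eta] gives a nonzero term, the set of odd edges of [n2].  The
    condition [n1 \in Omega A] is implied by the others, because [n2] has no
    sources and [A] is the set of odd vertices of [w.1]. *)
Lemma indicator_sum_parity {V : finType} {E : {set {set V}}} (A : {set V})
    (w : config E) (n1 n2 : current E) : Gamma A w ->
  ([&& n1 \in Omega A, n2 \in Omega finset.set0
    & conf (current_add n1 n2) == w] =
  \sum_(eta in parity_sets finset.set0) [forall e, edge_compat (e \in w.1)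
      (e \in conf_edges w) (e \in eta) (n1 e) (n2 e)] :> nat)%N.
Proof.
move=> wA; pose eta2 := (conf n2).1.
have in_eta2 e : e \in eta2 = odd (n2 e) by rewrite inE.
have -> : [&& n1 \in Omega A, n2 \in Omega finset.set0
      & conf (current_add n1 n2) == w] =
    (eta2 \in parity_sets finset.set0) && (conf (current_add n1 n2) == w).
  have -> : eta2 \in parity_sets finset.set0 = (n2 \in Omega finset.set0).
    rewrite inE -sourcesE.
    by apply/eqP/idP => [n20|/set_mem//]; exact: mem_set.
  have [n20|//] := boolP (n2 \in Omega finset.set0); last by rewrite andbF.
  have [nw|_] := eqVneq (conf _) w; last by rewrite !andbF.
  rewrite /= andbT; apply/mem_set; rewrite /Omega /=.
  rewrite -(sources_current_add n1 n2 (set_mem n20)) sourcesE nw.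
  exact: Gamma_parity.
rewrite big_mkcond (bigD1 eta2)//= big1 ?addn0 => [|eta eta_neq].
  rewrite conf_addE; last by move=> e; exact: Gamma_disjoint wA.
  case: ifP => //= _; congr (nat_of_bool _).
  by apply: eq_forallb => e; rewrite in_eta2.
case: ifP => // _; apply/eqP; rewrite eqb0; apply: contraNN eta_neq.
move=> /forallP eta_n; apply/eqP/setP => e.
by rewrite in_eta2; have /and3P[_ _ /eqP] := eta_n e.
Qed.

(** * Factorization over the edges *)

Lemma natr_forallb {R : comNzRingType} {I : finType} (P : pred I) :
  [forall i, P i]%:R = \prod_i (P i)%:R :> R.
Proof.
have [/forallP PT|] := boolP [forall i, P i]; first by rewrite big1// => i _; rewrite PT.
by rewrite negb_forall => /existsP[i /negbTE Pi]; rewrite (bigD1 i)//= Pi mul0r.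
Qed.

(** For each [eta] the sum over [n2] and then the sum over [n1] factorize over the
    edges.  The resulting product depends on [eta] only through the indicator that
    [eta] is contained in [w], so summing over [eta] counts these sets. *)
Lemma dcurr_induced_cosh_sinh {R : realType} {V : finType} {E : {set {set V}}}
    (J : edge E -> {posnum R}) (A : {set V}) (w : config E) : Gamma A w ->
  dcurr_induced J A [set w] =
  ((Zcurr J A * Zcurr J finset.set0)^-1
   * #|parity_subsets finset.set0 (conf_edges w)|%:R
   * \prod_e edge_weight (e \in w.1) (e \in conf_edges w) (J e)%:num)%:E.
Proof.
move=> wA; set Z := _^-1.
have Z0 : 0 <= Z by rewrite invr_ge0 mulr_ge0// Zcurr_ge0.
have J0 e : 0 <= (J e)%:num by [].
have op e : (e \in w.1) ==> (e \in conf_edges w).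
  by apply/implyP => ew; rewrite inE ew.
pose c (eta : {set edge E}) e := edge_compat (e \in w.1) (e \in conf_edges w) (e \in eta).
pose m (eta : {set edge E}) e := edge_marginal (e \in w.1) (e \in conf_edges w) (e \in eta)
  (J e)%:num.
have m_ge0 eta e a : 0 <= m eta e a by exact: edge_marginal_ge0.
have x_ge0 e a : 0 <= exp_coeff (J e)%:num a by exact: exp_coeff_ge0.
have W0 n : 0 <= weight J n by exact: weight_ge0.
rewrite dcurr_inducedE.
transitivity (\esum_(n1 in [set: current E])
    (Z%:E * \sum_(eta in parity_sets finset.set0)
      (\prod_e (exp_coeff (J e)%:num (n1 e) * m eta e (n1 e)))%:E))%E.
  apply: eq_esum => n1 _.
  transitivity (\esum_(n2 in [set: current E])
     ((Z * weight J n1)%:E * \sum_(eta in parity_sets finset.set0)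
      (\prod_e ((c eta e (n1 e) (n2 e))%:R
                 * exp_coeff (J e)%:num (n2 e)))%:E))%E.
    apply: eq_esum => n2 _; rewrite (indicator_sum_parity _ _ _ _ wA).
    rewrite sumEFin -EFinM natr_sum; congr EFin.
    rewrite mulr_sumr mulr_suml; apply: eq_bigr => eta _.
    rewrite natr_forallb big_split /=.
    rewrite -[\prod_e exp_coeff _ _]/(weight J n2) /Z invfM.
    ring.
  rewrite esumZl ?mulr_ge0//; last first.
    move=> n2; apply: sume_ge0 => eta _; rewrite lee_fin prodr_ge0// => e _.
    by rewrite mulr_ge0.
  rewrite esum_sum; last first.
    by move=> n2 eta _ _; rewrite lee_fin prodr_ge0// => e _; rewrite mulr_ge0.
  rewrite EFinM -muleA; congr (_ * _)%E.
  rewrite ge0_sume_distrr; last first.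
    by move=> eta _; apply: esum_ge0 => n2 _; rewrite lee_fin prodr_ge0// => e _;
      rewrite mulr_ge0.
  apply: eq_bigr => eta _; rewrite big_split /= EFinM; congr (_ * _)%E.
  apply: (esum_ffun_prod
    (fun e b => (c eta e (n1 e) b)%:R * exp_coeff (J e)%:num b)
    (fun e => m eta e (n1 e))) => [e b|e]; first by rewrite mulr_ge0.
  exact: esum_edge_marginal.
rewrite esumZl//; last first.
  move=> n1; apply: sume_ge0 => eta _; rewrite lee_fin prodr_ge0// => e _.
  by rewrite mulr_ge0.
rewrite esum_sum; last first.
  by move=> n1 eta _ _; rewrite lee_fin prodr_ge0// => e _; rewrite mulr_ge0.
rewrite -mulrA EFinM; congr (_ * _)%E.
transitivity (\sum_(eta in parity_sets finset.set0)
    ([forall e, (e \in eta) ==> (e \in conf_edges w)]%:R *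
     \prod_e edge_weight (e \in w.1) (e \in conf_edges w) (J e)%:num)%:E)%E.
  apply: eq_bigr => eta _; rewrite natr_forallb -big_split /=.
  apply: (esum_ffun_prod (fun e a => exp_coeff (J e)%:num a * m eta e a)).
    by move=> e a; rewrite mulr_ge0.
  by move=> e; exact: esum_edge_weight.
rewrite sumEFin -mulr_suml -natr_sum; congr (_%:R * _)%:E.
rewrite -sum1_card big_mkcond [RHS]big_mkcond; apply: eq_bigr => eta _.
rewrite [in RHS]inE; case: (eta \in _) => //=.
have -> : [forall e, (e \in eta) ==> (e \in conf_edges w)] =
    (eta \subset conf_edges w).
  by apply/forallP/fintype.subsetP => h e; apply/implyP/h.
by case: (_ \subset _).
Qed.

(** * From hyperbolic sines and cosines to hyperbolic tangents *)

Lemma parity_exp_gt0 {R : realType} (t : R) : 0 < parity_exp false t.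
Proof. by rewrite divr_gt0// expr0 mul1r addr_gt0// expR_gt0. Qed.

Lemma tanhE {R : realType} (t : R) :
  tanh t = parity_exp true t / parity_exp false t.
Proof.
rewrite /tanh /parity_exp expr0 expr1 mul1r mulN1r; field.
by rewrite gt_eqF// addr_gt0// expR_gt0.
Qed.

Lemma onem_tanh2 {R : realType} (t : R) :
  1 - tanh t ^+ 2 = (parity_exp false t ^+ 2)^-1.
Proof.
have := parity_expDB t; rewrite tanhE; have := parity_exp_gt0 t.
move: (parity_exp false t) (parity_exp true t) => C S C0 CS.
by rewrite -[RHS]mul1r -[in RHS]CS; field; rewrite gt_eqF.
Qed.

Lemma edge_weight_tanh {R : realType} (o p : bool) (t : R) : o ==> p ->
  edge_weight o p t * (1 - tanh t ^+ 2) =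
  (if o then tanh t else 1) * (if p && ~~ o then tanh t ^+ 2 else 1)
  * (if p then 1 else 1 - tanh t ^+ 2).
Proof.
rewrite /edge_weight; case: p => [_|].
  rewrite onem_tanh2 tanhE.
  by case: o => /=; field; rewrite gt_eqF// parity_exp_gt0.
by rewrite implybF => /negbTE->; rewrite !mul1r.
Qed.

Theorem theorem3p2 (R : realType) (V : finType) (E : {set {set V}})
    (E_simple : simple_graph E) (J : edge E -> {posnum R})
    (A : {set V}) (A_even : ~~ odd #|A|)
    (Omega_neq0 : Omega (E := E) A !=set0)
    (w : config E) (wA : Gamma A w) :
  let x (e : edge E) : R := tanh (J e)%:num in
  dcurr_induced J A [set w] =
    ((Zdcurr_bar J A)^-1
     * #|parity_subsets finset.set0 (conf_edges w)|%:R
     * \prod_(e in w.1) x e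
     * \prod_(e in w.2) x e ^+ 2
     * \prod_(e in ~: conf_edges w) (1 - x e ^+ 2))%:E.
Proof.
move=> x; rewrite (dcurr_induced_cosh_sinh _ _ _ wA) /Zdcurr_bar; congr EFin.
set P := \prod_e (1 - _).
have P0 : P != 0.
  apply/prodf_neq0 => e _; rewrite onem_tanh2 invr_neq0// expf_neq0//.
  by rewrite gt_eqF// parity_exp_gt0.
rewrite [(_ * P)^-1]invfM.
have -> : \prod_e edge_weight (e \in w.1) (e \in conf_edges w) (J e)%:num =
    P^-1 * (\prod_(e in w.1) x e * \prod_(e in w.2) x e ^+ 2 *
    \prod_(e in ~: conf_edges w) (1 - x e ^+ 2)).
  apply: (mulIf P0); rewrite mulrAC mulVf// mul1r -big_split/=.
  rewrite [\prod_(e in w.1) _]big_mkcond [\prod_(e in w.2) _]big_mkcond.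
  rewrite [\prod_(e in ~: _) _]big_mkcond -!big_split; apply: eq_bigr => e _.
  rewrite edge_weight_tanh /=; last by apply/implyP => ew; rewrite inE ew.
  rewrite !inE if_neg; congr (_ * _ * _).
  have := Gamma_disjoint _ _ e wA.
  by case: (e \in w.1) => [/(_ isT)/negbTE->//|_]; rewrite andbT.
ring.
Qed.
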